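(* Let $\alpha\in(0,1)$, and let $1<\gamma<1/(1-\alpha)$ be such that $\gamma\rho_\mu<1$. For $\epsilon>0$, the expected saved cost $s_\alpha(\pi_\mu)$ is $\epsilon$-approximated by $$\tilde s_{\alpha,\epsilon}(\pi_\mu)=\sum_{i=0}^k\pi_\mu(i)V_{\alpha,n_{\epsilon/2,k}}(i,0)-\sum_{i=0}^k\pi_\mu(i)V_{\alpha,n_{\epsilon/2,k}}(i,1),$$ i.e. $|s_\alpha(\pi_\mu)-\tilde s_{\alpha,\epsilon}(\pi_\mu)|\le\epsilon$, where $$k=\Big\lceil\log_{\gamma\rho_\mu}\Big(\frac{\epsilon(1-\gamma\rho_\mu)(1-(1-\alpha)\gamma)}{2u_M(1-\rho_\mu)}\Big)\Big\rceil$$ and, for $\epsilon'>0$ and $i\in\mathbb{N}_0$, $n_{\epsilon',i}=\Big\lceil\log_{(1-\alpha)\gamma}\Big(\frac{\epsilon'(1-(1-\alpha)\gamma)}{2u_M\gamma^i}\Big)\Big\rceil$.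
   Context: Model. Real parameters $\lambda,\beta>0$ and $0<\mu_1<\mu_2$ satisfy $\lambda+\mu_1+\mu_2+\beta=1$; service cost rates $0=c_{\mu_1}<c_{\mu_2}$; a fixed rate $\mu\in\{\mu_1,\mu_2\}$ with $\mu>\lambda$. The holding cost $h:\mathbb{N}_0\to\mathbb{R}$ satisfies $h(0)=0$, is non-negative, non-decreasing, convex, unbounded, and $\sum_{i\ge 0}h(i)x^i<\infty$ for all $0<x<1$. $\rho_\mu=\lambda/\mu$ and $\pi_\mu(i)=(1-\rho_\mu)\rho_\mu^i$, $i\in\mathbb{N}_0$. State space $S=\mathbb{N}_0\times\{0,1\}$. $\Phi$ is the set of stationary deterministic policies $\phi$, with $\phi(i,1)\in\{\mu_1,\mu_2\}$ and $\phi(i,0)=\mu$. Under $\phi$, the discrete-time Markov chain $(Y_n)$ on $S$ has the following transitions. From $(i,1)$ with $a=\phi(i,1)$: to $(i+1,1)$ w.p. $\lambda$, to $(i,0)$ w.p. $\beta$, to $(i-1,1)$ w.p. $a\mathbf 1_{\{i>0\}}$, to $(i,1)$ otherwise. From $(i,0)$: to $(i+1,0)$ w.p. $\lambda$, to $(i-1,0)$ w.p. $\mu\mathbf 1_{\{i>0\}}$, to $(i,0)$ otherwise. One-step costs: $c^\phi(i,1)=c_{\phi(i,1)}+h(i)$, $c^\phi(i,0)=c_\mu+h(i)$. $V^\phi_\alpha(x)=\mathbb{E}^\phi_x\big[\sum_{n\ge0}(1-\alpha)^nc^\phi(Y_n)\big]$. The expected discounted saved cost from initial queue length distribution $\pi_\mu$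 is $s_\alpha(\pi_\mu)=\sup_{\phi\in\Phi}s^\phi_\alpha(\pi_\mu)$ with $s^\phi_\alpha(\pi_\mu)=\sum_{i\ge0}\pi_\mu(i)\big(V_\alpha^\phi(i,0)-V_\alpha^\phi(i,1)\big)$. The constant $u_M$ satisfies $u_M\ge\sup_{\phi\in\Phi}\sup_{(i,q)\in S}|c^\phi(i,q)|/\gamma^i$. Write $i^+=\max\{i,0\}$. Value Iteration. $V_{\alpha,0}\equiv0$ and, for $n\ge 0$, $$V_{\alpha,n+1}(i,1)=h(i)+(1-\alpha)\big(\mu_1V_{\alpha,n}(i,1)+\mu_1V_{\alpha,n}((i-1)^+,1)+\lambda V_{\alpha,n}(i+1,1)+\beta V_{\alpha,n}(i,0)\big)+\min_{a\in\{\mu_1,\mu_2\}}\big\{c_a+(1-\alpha)\big((a-\mu_1)V_{\alpha,n}((i-1)^+,1)+(\mu_2-a)V_{\alpha,n}(i,1)\big)\big\},$$ $$V_{\alpha,n+1}(i,0)=c_\mu+h(i)+(1-\alpha)\big(\mu V_{\alpha,n}((i-1)^+,0)+(1-\mu-\lambda)V_{\alpha,n}(i,0)+\lambda V_{\alpha,n}(i+1,0)\big).$$ *)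

(* Defs.v *)
From HB Require Import structures.
From mathcomp Require Import all_boot all_order all_algebra.
From mathcomp Require Import all_classical all_reals all_analysis.

Set Implicit Arguments.
Unset Strict Implicit.
Unset Printing Implicit Defensive.

Import Order.TTheory GRing.Theory Num.Theory.
Import numFieldNormedType.Exports.

Local Open Scope classical_set_scope.
Local Open Scope ring_scope.

(* A state (i, q) is a queue length i and a flag q, with [true] for q = 1. *)
Notation state := (nat * bool)%type.

Section Model.
Variable R : realType.

(* A stationary deterministic policy is the map sending a state to the service
   rate used there; in the states (i, 0) this is the fixed rate [mu]. *)
Definition policies (mu1 mu2 mu : R) : set (state -> R) :=
  [set phi | (forall i, phi (i, true) = mu1 \/ phi (i, true) = mu2) /\
             (forall i, phi (i, false) = mu)].

(* The four targets are pairwise distinct whenever the corresponding branch can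
   be reached, so the order of the tests is immaterial. *)
Definition trans (lambda beta : R) (phi : state -> R) (x y : state) : R :=
  let: (i, q) := x in
  let a := phi x in
  if q then
    if y == (i.+1, true) then lambda
    else if y == (i, false) then beta
    else if (0 < i)%N && (y == (i.-1, true)) then a
    else if y == (i, true) then 1 - lambda - beta - a * (0 < i)%N%:R
    else 0
  else
    if y == (i.+1, false) then lambda
    else if (0 < i)%N && (y == (i.-1, false)) then a
    else if y == (i, false) then 1 - lambda - a * (0 < i)%N%:R
    else 0.

(* [c a] is the service cost rate c_a of the service rate [a]. *)
Definition cost (c : R -> R) (h : nat -> R) (phi : state -> R) (x : state) : R :=
  c (phi x) + h x.1.

Section Chain.
Context d (T : measurableType d).

Definition cond_prob (P : probability T R) (A B : set T) : R :=
  fine (P (A `&` B)) / fine (P B).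

Definition history (Y : nat -> T -> state) (n : nat) (xs : nat -> state) : set T :=
  [set w | forall m, (m <= n)%N -> Y m w = xs m].

Definition is_markov_chain (P : probability T R) (Y : nat -> T -> state)
    (x : state) (p : state -> state -> R) : Prop :=
  [/\ forall n, measurable_fun [set: T] (Y n),
      P [set w | Y 0%N w = x] = 1%E
    & forall (n : nat) (xs : nat -> state) (y : state),
        P (history Y n xs) != 0%E ->
        cond_prob P [set w | Y n.+1 w = y] (history Y n xs) = p (xs n) y].

(* [P phi x] is the law under which [Y] starts in [x] and follows [phi]. *)
Variables (P : (state -> R) -> state -> probability T R) (Y : nat -> T -> state).

Definition value (c : R -> R) (h : nat -> R) (alpha : R)
    (phi : state -> R) (x : state) : \bar R :=
  (\int[P phi x]_w
     \sum_(0 <= n <oo) ((1 - alpha) ^+ n * cost c h phi (Y n w))%:E)%E.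

Definition saved_cost_of (c : R -> R) (h : nat -> R) (alpha : R)
    (pi0 : nat -> R) (phi : state -> R) : \bar R :=
  (\sum_(0 <= i <oo) ((pi0 i)%:E *
     (value c h alpha phi (i, false) - value c h alpha phi (i, true))))%E.

Definition saved_cost (Phi : set (state -> R)) (c : R -> R) (h : nat -> R)
    (alpha : R) (pi0 : nat -> R) : \bar R :=
  ereal_sup [set saved_cost_of c h alpha pi0 phi | phi in Phi].

End Chain.

Definition geom_dist (rho : R) (i : nat) : R := (1 - rho) * rho ^+ i.

(* Predecessor on [nat] is truncated: [i.-1] is (i - 1)^+. *)
Fixpoint value_iter (lambda beta mu1 mu2 mu : R) (c : R -> R) (h : nat -> R)
    (alpha : R) (n : nat) (x : state) : R :=
  if n isn't n'.+1 then 0 else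
  let V := value_iter lambda beta mu1 mu2 mu c h alpha n' in
  let i := x.1 in
  if x.2 then
    let action_cost a :=
      c a + (1 - alpha) *
        ((a - mu1) * V (i.-1, true) + (mu2 - a) * V (i, true)) in
    h i
    + (1 - alpha) * (mu1 * V (i, true) + mu1 * V (i.-1, true)
                     + lambda * V (i.+1, true) + beta * V (i, false))
    + Num.min (action_cost mu1) (action_cost mu2)
  else
    c mu + h i
    + (1 - alpha) * (mu * V (i.-1, false) + (1 - mu - lambda) * V (i, false)
                     + lambda * V (i.+1, false)).

Definition log_base (b x : R) : R := ln x / ln b.

(* Positive part of an integer, as a natural number. *)
Definition pos_part (z : int) : nat := if z is Posz m then m else 0%N.

(* For large [eps] the ceiling can be negative; no iteration is then needed. *)
Definition n_iter (alpha gamma uM eps : R) (i : nat) : nat :=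
  pos_part (Num.ceil (log_base ((1 - alpha) * gamma)
    (eps * (1 - (1 - alpha) * gamma) / (2 * uM * gamma ^+ i)))).

Definition truncation (alpha gamma rho uM eps : R) : int :=
  Num.ceil (log_base (gamma * rho)
    (eps * (1 - gamma * rho) * (1 - (1 - alpha) * gamma)
     / (2 * uM * (1 - rho)))).

(* The sums over 0 <= i <= k have [pos_part (k + 1)] terms: none if k < 0, in
   which case the value of [n] does not matter. *)
Definition approx_saved_cost (lambda beta mu1 mu2 mu : R) (c : R -> R)
    (h : nat -> R) (alpha gamma uM eps : R) : R :=
  let rho := lambda / mu in
  let k := truncation alpha gamma rho uM eps in
  let n := n_iter alpha gamma uM (eps / 2) (pos_part k) in
  let V := value_iter lambda beta mu1 mu2 mu c h alpha n in
  \sum_(i < pos_part (k + 1)) geom_dist rho i * V (i : nat, false)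
  - \sum_(i < pos_part (k + 1)) geom_dist rho i * V (i : nat, true).

End Model.

(* Main.v *)
Require Import Defs.
From HB Require Import structures.
From mathcomp Require Import all_boot all_order all_algebra.
From mathcomp Require Import all_classical all_reals all_analysis.
From mathcomp Require Import measurable_realfun.
From mathcomp Require Import ring lra zify.

(* Under a policy phi the expected n-step discounted costs W_n satisfy
   W_{n+1} = cost + (1 - alpha) K_phi W_n, where K_phi is the one-step
   expectation; this holds because E[g(Y_{m+j}) ; Y_0..Y_m] = K_phi^j g (Y_m) on
   each history. Since K_phi multiplies the weight gamma^i by at most gamma, it
   contracts with factor q = (1 - alpha) gamma after discounting.

   Value iteration V_n minimises over actions, so V_n <= W_n <= V^phi. No
   optimal policy is needed for the converse: if phi_n is greedy for V_n, then
   V_n + u_M q^n gamma^i / (1 - q) is a supersolution of the equation of phi_n,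
   hence bounds V^phi_n from above. In the states (i, 0) all policies agree, so
   there the two-sided estimate holds for all phi. The bound
   V^phi(i, q) <= u_M gamma^i / (1 - q) controls the terms i > k. *)
Set Implicit Arguments.
Unset Strict Implicit.
Unset Printing Implicit Defensive.

Import Order.TTheory GRing.Theory Num.Theory.
Import numFieldNormedType.Exports.
Local Open Scope classical_set_scope.
Local Open Scope ring_scope.

(** * One-step expectation operator and finite-horizon costs *)

Section Step.
Context (R : realType) (lambda beta : R) (phi : state -> R).

(* At queue length 0 a service leaves the queue empty, so [i.-1] matches
   the factor 1_{i>0} of [trans]. *)
Definition step (g : state -> R) (x : state) : R :=
  let: (i, q) := x in
  if q then lambda * g (i.+1, true) + beta * g (i, false)
            + phi x * g (i.-1, true) + (1 - lambda - beta - phi x) * g (i, true)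
  else lambda * g (i.+1, false) + phi x * g (i.-1, false)
       + (1 - lambda - phi x) * g (i, false).

(** Expected discounted cost of the first [n] steps from [x], written without a probability space:
    [iter m step] stands for the expectation after [m] steps. *)
Definition horizon_cost (c : R -> R) (h : nat -> R) (alpha : R) (n : nat)
    (x : state) : R :=
  \sum_(m < n) (1 - alpha) ^+ m * iter m step (cost c h phi) x.

Lemma step_sum (n : nat) (a : nat -> R) (g : nat -> state -> R) (x : state) :
  step (fun y => \sum_(m < n) a m * g m y) x = \sum_(m < n) a m * step (g m) x.
Proof.
case: x => i [] /=; rewrite !mulr_sumr -!big_split /=; apply: eq_bigr => m _;
  ring.
Qed.

Lemma horizon_costS (c : R -> R) (h : nat -> R) (alpha : R) (n : nat)
    (x : state) :
  horizon_cost c h alpha n.+1 x =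
  cost c h phi x + (1 - alpha) * step (horizon_cost c h alpha n) x.
Proof.
rewrite /horizon_cost step_sum big_ord_recl /= expr0 mul1r; congr (_ + _).
rewrite mulr_sumr; apply: eq_bigr => m _.
by rewrite /bump /= add1n exprS mulrA.
Qed.

Context (lambda_ge0 : 0 <= lambda) (beta_ge0 : 0 <= beta)
  (phi_ge0 : forall x, 0 <= phi x)
  (phi_le : forall x, phi x <= 1 - lambda - beta).

Local Ltac rates_lra := have := lambda_ge0; have := beta_ge0; lra.

Lemma step_le (f g : state -> R) (x : state) :
  (forall y, f y <= g y) -> step f x <= step g x.
Proof.
move=> fg; have b1 := phi_ge0 x; have b2 := phi_le x.
by case: x b1 b2 => i [] b1 b2 /=; rewrite !lerD// ler_wpM2l//; rates_lra.
Qed.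

Lemma step_ge0 (f : state -> R) (x : state) :
  (forall y, 0 <= f y) -> 0 <= step f x.
Proof.
move=> f0; have b1 := phi_ge0 x; have b2 := phi_le x.
by case: x b1 b2 => i [] b1 b2 /=; rewrite !addr_ge0// mulr_ge0//; rates_lra.
Qed.

Lemma step_const (a : R) (x : state) : step (fun=> a) x = a.
Proof. by case: x => i [] /=; ring. Qed.

Lemma stepD (f g : state -> R) (x : state) :
  step (fun y => f y + g y) x = step f x + step g x.
Proof. by case: x => i [] /=; ring. Qed.

Lemma stepZ (a : R) (f : state -> R) (x : state) :
  step (fun y => a * f y) x = a * step f x.
Proof. by case: x => i [] /=; ring. Qed.

(** Every successor has queue length at most [x.1.+1], so the weight is dominated there by the
    constant [gamma ^+ x.1.+1], which [step] preserves. *)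
Lemma step_weight (gamma : R) (x : state) : 1 <= gamma ->
  step (fun y => gamma ^+ y.1) x <= gamma ^+ x.1.+1.
Proof.
move=> g1; rewrite -[leRHS](step_const _ x).
have b1 := phi_ge0 x; have b2 := phi_le x.
by case: x b1 b2 => i [] b1 b2 /=; rewrite !lerD// ler_wpM2l//;
  [rewrite ler_weXn2l//; lia | rewrite ler_weXn2l//; lia | rates_lra
  | rewrite ler_weXn2l//; lia | rewrite ler_weXn2l//; lia | rates_lra
  | rewrite ler_weXn2l//; lia].
Qed.

Lemma iter_step_ge0 (g : state -> R) (n : nat) (x : state) :
  (forall y, 0 <= g y) -> 0 <= iter n step g x.
Proof. by move=> g0; elim: n x => [|n IH] x //=; exact: step_ge0. Qed.

(* Comparison principle: a nonnegative supersolution of the equation of phi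
   dominates all finite-horizon costs. *)
Lemma horizon_cost_le (c : R -> R) (h : nat -> R) (alpha : R)
    (U : state -> R) (n : nat) (x : state) :
  alpha <= 1 -> (forall y, 0 <= U y) ->
  (forall y, cost c h phi y + (1 - alpha) * step U y <= U y) ->
  horizon_cost c h alpha n x <= U x.
Proof.
move=> a1 U0 US; elim: n x => [|n IH] x.
  by rewrite /horizon_cost big_ord0.
rewrite horizon_costS; apply: le_trans (US x); rewrite lerD2l ler_wpM2l//.
  by rewrite subr_ge0.
exact: step_le.
Qed.

End Step.

(** * Expectations along a Markov chain on a countable state space *)

Section MarkovChain.
Context (R : realType).

Lemma measurable_state (A : set state) : measurable A.
Proof.
apply: countable_measurable; last exact: countableP.
move=> [i b]; rewrite (_ : [set (i, b)] = [set i] `*` [set b]).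
  exact: measurableX.
by apply/seteqP; split => [[j b'] [-> ->]|[j b'] [/= -> ->]].
Qed.

Lemma measurable_state_fun (f : state -> R) : measurable_fun setT f.
Proof. by move=> _ A _; exact: measurable_state. Qed.

Definition set_state (xs : nat -> state) (n : nat) (y : state) (m : nat) :
    state :=
  if m == n then y else xs m.

Context (d : measure_display) (T : measurableType d).
Context (P : probability T R) (Y : nat -> T -> state).

Lemma history_set_state (xs : nat -> state) (n : nat) (y : state) :
  history Y n.+1 (set_state xs n.+1 y) =
  [set w | Y n.+1 w = y] `&` history Y n xs.
Proof.
apply/seteqP; split => w /=; rewrite /history /set_state /=.
  move=> H; split; first by have := H n.+1 (leqnn _); rewrite eqxx.
  by move=> m mn; have := H m (leqW mn); rewrite ifF//; apply/eqP => e; lia.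
move=> [H1 H2] m mn; case: eqP => [->//|/eqP mn1]; apply: H2; lia.
Qed.

Context (x : state) (p : state -> state -> R) (succs : state -> seq state).
Context (Y_chain : is_markov_chain P Y x p).
Context (p_ge0 : forall y z, 0 <= p y z) (succs_uniq : forall y, uniq (succs y))
  (p_sum : forall y, \sum_(z <- succs y) p y z = 1).

(** By [p_sum] the finite list [succs y] carries all the mass of [p y], so this finite sum is the
    full one-step expectation. *)
Definition expect_next (g : state -> R) (y : state) : R :=
  \sum_(z <- succs y) p y z * g z.

Lemma iter_expect_next_ge0 (n : nat) (g : state -> R) (y : state) :
  (forall z, 0 <= g z) -> 0 <= iter n expect_next g y.
Proof.
move=> g0; elim: n y => [|n IH] y //=.
by apply: sumr_ge0 => z _; rewrite mulr_ge0.
Qed.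

Lemma measurable_history (n : nat) (xs : nat -> state) :
  measurable (history Y n xs).
Proof.
have [mY _ _] := Y_chain.
rewrite (_ : history Y n xs =
    \bigcap_(m in [set m | (m <= n)%N]) (Y m @^-1` [set xs m])).
  apply: bigcap_measurable; first by exists 0%N.
  move=> m _; rewrite -[X in measurable X]setTI.
  by apply: (mY m) => //; exact: measurable_state.
by apply/seteqP; split=> w H m /= mn; exact: H.
Qed.

Lemma measurable_observable (n : nat) (g : state -> R) (A : set T) :
  measurable_fun A (EFin \o (g \o Y n)).
Proof.
have [mY _ _] := Y_chain.
apply: measurable_funTS; apply/measurable_EFinP.
exact: measurableT_comp (measurable_state_fun g) (mY n).
Qed.

(** On a history of positive probability this is the Markov property; on a null history both sides
    vanish. *)
Lemma probability_history_next (n : nat) (xs : nat -> state) (y : state) :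
  P (history Y n.+1 (set_state xs n.+1 y)) =
  (P (history Y n xs) * (p (xs n) y)%:E)%E.
Proof.
have [_ _ markov] := Y_chain.
have mH := measurable_history n xs.
have mF := measurable_history n.+1 (set_state xs n.+1 y).
have finF : P (history Y n.+1 (set_state xs n.+1 y)) \is a fin_num.
  exact: fin_num_measure.
have finH : P (history Y n xs) \is a fin_num by exact: fin_num_measure.
have [H0|H0] := eqVneq (P (history Y n xs)) 0%E.
  rewrite H0 mul0e; apply/eqP; rewrite eq_le measure_ge0 andbT -H0.
  by apply: le_measure; rewrite ?inE// history_set_state; apply: subIsetr.
have := markov n xs y H0; rewrite /cond_prob -history_set_state => <-.
rewrite -[in RHS](fineK finH) -EFinM mulrC divfK ?fineK//.
by rewrite fine_eq0.
Qed.

(** Induction on [j] with the history left free: the history is split by the state at time [n.+1],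
    and each piece is a longer history with one step less to go. *)
Lemma integral_history (j n : nat) (xs : nat -> state) (g : state -> R) :
  (forall y, 0 <= g y) ->
  (\int[P]_(w in history Y n xs) (g (Y (n + j)%N w))%:E =
   P (history Y n xs) * (iter j expect_next g (xs n))%:E)%E.
Proof.
move=> g0; elim: j n xs => [|j IH] n xs.
  have mH := measurable_history n xs.
  rewrite addn0 (eq_integral (fun=> (g (xs n))%:E)) => [|w].
    by rewrite integral_cst// muleC.
  by rewrite inE => /(_ n (leqnn n)) ->.
set A := history Y n xs; pose F y := history Y n.+1 (set_state xs n.+1 y).
have mA : measurable A by exact: measurable_history.
have mF y : measurable (F y) by exact: measurable_history.
pose D := \big[setU/set0]_(y <- succs (xs n)) F y.
have mD : measurable D by exact: bigsetU_measurable.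
have tF : trivIset [set` succs (xs n)] F.
  move=> y z _ _ [w]; rewrite /F !history_set_state.
  by move=> [[/= -> _] [/= -> _]].
have DA : D `<=` A.
  rewrite /D big_seq; apply: (big_ind (fun B => B `<=` A)) => //.
    by move=> B C BA CA w [/BA|/CA].
  by move=> y _; rewrite /F history_set_state; exact: subIsetr.
have finA : P A \is a fin_num by exact: fin_num_measure.
(* The listed successors exhaust [A] up to a null set, because their transition probabilities sum to
   1. *)
have PD : P D = P A.
  transitivity (\sum_(y <- succs (xs n)) P (F y))%E.
    rewrite -[LHS]mul1e -integral_cst// ge0_integral_bigsetU//.
    by apply: eq_bigr => y _; rewrite integral_cst// mul1e.
  under eq_bigr do rewrite /F probability_history_next -/A.
  rewrite -(fineK finA) -ge0_sume_distrr ?sumEFin ?p_sum ?mule1//.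
  by move=> y _; rewrite lee_fin.
have N0 : P (A `\` D) = 0%E.
  rewrite measureD// ?(setIidr DA).
    by transitivity (P A - P A)%E; [congr (_ - _)%E; exact: PD | exact: subee].
  by rewrite -ge0_fin_numE.
rewrite (ge0_negligible_integral _ mA _ _ N0)//.
- rewrite setDD (setIidr DA) /D ge0_integral_bigsetU//.
  + rewrite /= /expect_next -sumEFin ge0_sume_distrr.
      apply: eq_bigr => y _.
      rewrite /F -addSnnS IH probability_history_next.
      by rewrite /set_state eqxx EFinM muleA.
    move=> y _; rewrite lee_fin mulr_ge0//.
    exact: iter_expect_next_ge0.
  + exact: measurable_observable.
  + by move=> w _; rewrite lee_fin.
- exact: measurableD.
- exact: measurable_observable.
- by move=> w _; rewrite lee_fin.
Qed.

(** The chain starts in [x] almost surely, so the whole integral lives on the history of time 0 at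
    [x]. *)
Lemma expectation_chain (n : nat) (g : state -> R) : (forall y, 0 <= g y) ->
  (\int[P]_w (g (Y n w))%:E = (iter n expect_next g x)%:E)%E.
Proof.
move=> g0; have [_ Y0 _] := Y_chain.
have mH := measurable_history 0 (fun=> x).
have PH : P (history Y 0 (fun=> x)) = 1%E.
  rewrite -Y0; congr (P _); apply/seteqP; split=> w /=; first exact.
  by move=> e m; rewrite leqn0 => /eqP ->.
rewrite (ge0_negligible_integral (measurableC mH))//.
- by rewrite setTD setCK -[n]add0n integral_history// PH mul1e.
- exact: measurable_observable.
- by move=> w _; rewrite lee_fin.
- by apply: etrans (probability_setC _ mH) _; rewrite PH subee.
Qed.

End MarkovChain.

(** * The transition law of the queue and its value function as a series *)

Section ModelChain.
Context (R : realType) (lambda beta : R) (phi : state -> R).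
Context (lambda_ge0 : 0 <= lambda) (beta_ge0 : 0 <= beta)
  (phi_ge0 : forall x, 0 <= phi x)
  (phi_le : forall x, phi x <= 1 - lambda - beta).

(** One shape serves both flags: from [(i, false)] the entry [(i, true)] has probability 0. At
    [i = 0] the predecessor is left out, as [i.-1] would repeat [(0, q)]. *)
Definition successors (x : state) : seq state :=
  let: (i, q) := x in
  [:: (i.+1, q); (i, ~~ q); (i, q)]
  ++ (if i is i'.+1 then [:: (i', q)] else [::]).

Lemma successors_uniq (x : state) : uniq (successors x).
Proof.
by case: x => [[|i] []]; rewrite //= !inE !xpair_eqE /=; lia.
Qed.

Lemma trans_ge0 (x y : state) : 0 <= trans lambda beta phi x y.
Proof.
case: x => i q; rewrite /trans.
have b1 := phi_ge0 (i, q); have b2 := phi_le (i, q).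
move: lambda_ge0 beta_ge0 => l0 b0.
by case: q b1 b2 => b1 b2; do ![case: ifP => // _];
  case: i b1 b2 => [|i] b1 b2 /=; lra.
Qed.

Lemma expect_next_trans (g : state -> R) (x : state) :
  expect_next (trans lambda beta phi) successors g x = step lambda beta phi g x.
Proof.
rewrite /expect_next /trans; case: x => [[|i] []] /=;
  rewrite !big_cons big_nil ?xpair_eqE /= ?eqSS ?eqxx ?andbT ?andbF /=.
1,2: ring.
all: have -> : (i == i.+1) = false by lia.
all: have -> : (i.+1 == i) = false by lia.
all: have -> : (i == i.+2) = false by lia.
all: ring.
Qed.

Lemma sum_trans (x : state) :
  \sum_(y <- successors x) trans lambda beta phi x y = 1.
Proof.
rewrite -[RHS](step_const lambda beta phi 1 x) -expect_next_trans.
by apply: eq_bigr => y _; rewrite mulr1.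
Qed.

Context (c : R -> R) (h : nat -> R) (alpha : R).
Context (cost_ge0 : forall x, 0 <= cost c h phi x) (alpha_le1 : alpha <= 1).
Context (d : measure_display) (T : measurableType d).
Context (P : (state -> R) -> state -> probability T R) (Y : nat -> T -> state).
Context (Y_chain : forall x,
  is_markov_chain (P phi x) Y x (trans lambda beta phi)).

(** Costs are nonnegative, so Tonelli exchanges integral and series; [expectation_chain] evaluates
    each term. *)
Lemma value_eseries (x : state) :
  value P Y c h alpha phi x =
  (\sum_(0 <= n <oo) ((1 - alpha) ^+ n
     * iter n (step lambda beta phi) (cost c h phi) x)%:E)%E.
Proof.
have disc_ge0 n : 0 <= (1 - alpha) ^+ n by rewrite exprn_ge0// subr_ge0.
rewrite /value integral_nneseries//.
- apply: eq_eseriesr => n _; under eq_integral do rewrite EFinM.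
  rewrite ge0_integralZl_EFin//.
  + rewrite (expectation_chain (Y_chain x) trans_ge0 successors_uniq
            sum_trans)//.
    have -> : expect_next (trans lambda beta phi) successors =
              step lambda beta phi.
      by apply/funext => g; apply/funext => y; exact: expect_next_trans.
    by rewrite EFinM.
  + by move=> w _; rewrite lee_fin.
  + exact: (measurable_observable (Y_chain x) n (cost c h phi)).
- move=> n.
  exact: (measurable_observable (Y_chain x) n
    (fun y => (1 - alpha) ^+ n * cost c h phi y)).
- by move=> n w _; rewrite lee_fin mulr_ge0.
Qed.

(** The horizon costs are the partial sums of a nonnegative series; a uniform bound makes its limit
    a real number. *)
Lemma value_bounds (x : state) (U : R) :
  (forall n, horizon_cost lambda beta phi c h alpha n x <= U) ->
  exists2 v, value P Y c h alpha phi x = v%:E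
    & (forall n, horizon_cost lambda beta phi c h alpha n x <= v) /\ v <= U.
Proof.
move=> WU; rewrite value_eseries; set S := limn _.
pose a n : \bar R :=
  ((1 - alpha) ^+ n * iter n (step lambda beta phi) (cost c h phi) x)%:E.
have a_ge0 n : (0 <= a n)%E.
  rewrite lee_fin mulr_ge0 ?exprn_ge0 ?subr_ge0//.
  by apply: iter_step_ge0.
have partial n : (\sum_(0 <= i < n) a i =
    (horizon_cost lambda beta phi c h alpha n x)%:E)%E.
  by rewrite sumEFin big_mkord.
have S_le : (S <= U%:E)%E.
  apply: lime_le; first exact: (is_cvg_nneseries (fun n _ _ => a_ge0 n)).
  by apply: nearW => n; rewrite partial lee_fin.
have S_ge n : ((horizon_cost lambda beta phi c h alpha n x)%:E <= S)%E.
  by rewrite -partial; exact: nneseries_lim_ge.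
have S_fin : S \is a fin_num.
  by rewrite fin_real// (lt_le_trans (ltNyr _) (S_ge 0%N))
    (le_lt_trans S_le (ltry _)).
by exists (fine S); [rewrite fineK|split=> [n|]; rewrite -lee_fin fineK].
Qed.

End ModelChain.

(** * Logarithmic thresholds and geometric series *)

Lemma expr_le_log_base (R : realType) (b x : R) (m : nat) :
  0 < b -> b < 1 -> 0 < x -> Num.ceil (log_base b x) <= m%:Z -> b ^+ m <= x.
Proof.
move=> b0 b1 x0 km.
(* Dividing by the negative [ln b] reverses the inequality, so exponents above the logarithm make
   the power small. *)
have lnb : ln b < 0 by rewrite ln_lt0// b0.
rewrite -ler_ln ?posrE ?exprn_gt0// lnXn// -mulr_natl -ler_ndivrMr//.
by apply: le_trans (ceil_ge _) _; rewrite -(ler_int R) in km.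
Qed.

Lemma le_pos_part (z : int) : z <= (pos_part z)%:Z.
Proof. by case: z. Qed.

Lemma leq_pos_part (z : int) (i : nat) :
  (i < pos_part (z + 1))%N -> (i <= pos_part z)%N.
Proof. by case: z => [m|[|m]] //; rewrite -PoszD addn1. Qed.

Lemma sum_geometric_tail (R : realFieldType) (r : R) (k j : nat) : r < 1 ->
  \sum_(k <= i < k + j) r ^+ i = (r ^+ k - r ^+ (k + j)) / (1 - r).
Proof.
move=> r1; elim: j => [|j IH]; first by rewrite addn0 big_geq// subrr mul0r.
rewrite addnS big_nat_recr ?leq_addr//= IH exprS.
by field; lra.
Qed.

(** The terms may change sign; comparison with a geometric series gives absolute convergence, hence
    a real sum, and its tail bounds the error. *)
Lemma eseries_geometric (R : realType) (a : nat -> R) (C r : R) (k : nat) :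
  0 <= C -> 0 <= r -> r < 1 -> (forall i, `|a i| <= C * r ^+ i) ->
  exists2 l, (\sum_(0 <= i <oo) (a i)%:E = l%:E)%E
    & `|l - \sum_(i < k) a i| <= C * r ^+ k / (1 - r).
Proof.
move=> C0 r0 r1 aC.
have cvg_a : cvgn (series a).
  apply: normed_cvg; apply: (@series_le_cvg _ _ (geometric C r)) .
  - by move=> n; exact: normr_ge0.
  - by move=> n; exact: mulr_ge0 C0 (exprn_ge0 _ r0).
  - exact: aC.
  - by apply: is_cvg_geometric_series; rewrite ger0_norm.
exists (limn (series a)).
  rewrite -EFin_lim//; congr (limn _); apply/funext => n /=.
  by rewrite sumEFin.
have dist_cvg : `|series a n - \sum_(i < k) a i| @[n --> \oo] -->
    `|limn (series a) - \sum_(i < k) a i|.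
  by apply: cvg_norm; apply: cvgB => //; exact: cvg_cst.
(* The bound holds for all partial sums with [n >= k] and passes to the limit. *)
apply: (cvgr_to_le dist_cvg); near=> n.
have kn : (k <= n)%N by near: n; exists k.
rewrite /series /= -(big_mkord xpredT) (big_cat_nat (leq0n k) kn)//=.
rewrite addrAC subrr add0r.
apply: le_trans (ler_norm_sum _ _ _) _.
apply: (@le_trans _ _ (\sum_(k <= i < n) C * r ^+ i)).
  by apply: ler_sum => i _; exact: aC.
rewrite -mulr_sumr -(subnKC kn) sum_geometric_tail// mulrA ler_wpM2r//.
  by rewrite invr_ge0 subr_ge0 ltW.
by rewrite ler_wpM2l// lerBlDr lerDl exprn_ge0.
Unshelve. all: by end_near. Qed.

(** * Value iteration against the costs of a fixed policy *)

Section Model.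
Context (R : realType) (lambda beta mu1 mu2 mu : R) (c : R -> R) (h : nat -> R).
Context (lambda_gt0 : 0 < lambda) (beta_gt0 : 0 < beta)
  (mu1_gt0 : 0 < mu1) (mu12 : mu1 < mu2)
  (rates_sum : lambda + mu1 + mu2 + beta = 1)
  (mu_rate : mu = mu1 \/ mu = mu2)
  (c_mu1 : 0 <= c mu1) (c_mu2 : 0 <= c mu2) (h_ge0 : forall i, 0 <= h i)
  (alpha : R) (alpha_gt0 : 0 < alpha) (alpha_lt1 : alpha < 1).

Local Notation V := (value_iter lambda beta mu1 mu2 mu c h alpha).
Local Notation policy := (policies mu1 mu2 mu).
Local Notation K := (step lambda beta).
Local Notation W := (horizon_cost lambda beta ^~ c).

Local Ltac model_lra :=
  move: lambda_gt0 beta_gt0 mu1_gt0 mu12 rates_sum alpha_gt0 alpha_lt1; lra.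

Lemma policy_rate (phi : state -> R) (x : state) :
  policy phi -> phi x = mu1 \/ phi x = mu2.
Proof.
by case=> phi1 phi0; case: x => i []; [exact: phi1 | rewrite phi0].
Qed.

Lemma policy_ge0 (phi : state -> R) (x : state) : policy phi -> 0 <= phi x.
Proof. by move=> /(policy_rate x)[] ->; model_lra. Qed.

Lemma policy_le (phi : state -> R) (x : state) :
  policy phi -> phi x <= 1 - lambda - beta.
Proof. by move=> /(policy_rate x)[] ->; model_lra. Qed.

Lemma policy_cost_ge0 (phi : state -> R) (x : state) :
  policy phi -> 0 <= cost c h phi x.
Proof. by move=> /(policy_rate x) pr; rewrite addr_ge0//; case: pr => ->. Qed.

Definition action_value (f : state -> R) (i : nat) (a : R) : R :=
  c a + (1 - alpha) * ((a - mu1) * f (i.-1, true) + (mu2 - a) * f (i, true)).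

Definition greedy (n : nat) (x : state) : R :=
  if x.2 then
    if action_value (V n) x.1 mu1 <= action_value (V n) x.1 mu2 then mu1
    else mu2
  else mu.

Lemma greedy_policy (n : nat) : policy (greedy n).
Proof.
by split=> i //; rewrite /greedy /=; case: ifP => _; [left|right].
Qed.

(** As the rates sum to 1, the self-loop mass under action [a] is [mu1 + (mu2 - a)]; this isolates
    the part that value iteration minimises. *)
Lemma bellman_action (phi f : state -> R) (i : nat) :
  cost c h phi (i, true) + (1 - alpha) * K phi f (i, true) =
  h i + (1 - alpha) * (mu1 * f (i, true) + mu1 * f (i.-1, true)
                       + lambda * f (i.+1, true) + beta * f (i, false))
  + action_value f i (phi (i, true)).
Proof.
rewrite /cost /action_value /=.
have -> : 1 - lambda - beta - phi (i, true) = mu1 + mu2 - phi (i, true).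
  by model_lra.
ring.
Qed.

Lemma value_iter_le (phi : state -> R) (n : nat) (x : state) : policy phi ->
  V n.+1 x <= cost c h phi x + (1 - alpha) * K phi (V n) x.
Proof.
move=> pphi; case: x => i [].
  rewrite bellman_action /= lerD2l.
  case: (pphi.1 i) => ->; rewrite ge_min /action_value lexx ?orbT//.
by rewrite /= /cost /= pphi.2 le_eqVlt; apply/orP; left; apply/eqP; ring.
Qed.

Lemma value_iter_greedy (n : nat) (x : state) :
  V n.+1 x = cost c h (greedy n) x + (1 - alpha) * K (greedy n) (V n) x.
Proof.
case: x => i [].
  rewrite bellman_action /=; congr (_ + _).
  by rewrite /greedy /= -!/(action_value _ _ _); case: leP.
by rewrite /= /cost /= /greedy /=; ring.
Qed.

Lemma value_iter_le_horizon_cost (phi : state -> R) (n : nat) (x : state) :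
  policy phi -> V n x <= W phi h alpha n x.
Proof.
move=> pphi; elim: n x => [|n IH] x; first by rewrite /horizon_cost big_ord0.
apply: le_trans (value_iter_le n x pphi) _.
rewrite horizon_costS lerD2l ler_wpM2l//; first by model_lra.
apply: (step_le (ltW lambda_gt0) (ltW beta_gt0)) => //.
- by move=> y; exact: policy_ge0.
- by move=> y; exact: policy_le.
Qed.

(** From [(i, false)] the flag never changes and the rate is [mu], so both sides obey the same
    recursion. *)
Lemma value_iter_false (phi : state -> R) (n i : nat) : policy phi ->
  W phi h alpha n (i, false) = V n (i, false).
Proof.
move=> pphi; elim: n i => [|n IH] i; first by rewrite /horizon_cost big_ord0.
by rewrite horizon_costS /= /cost !IH pphi.2 /=; ring.
Qed.

Lemma value_iter_ge0 (n : nat) (x : state) : 0 <= V n x.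
Proof.
elim: n x => [|n IH] x //; rewrite value_iter_greedy.
have pg := greedy_policy n.
rewrite addr_ge0 ?policy_cost_ge0// mulr_ge0//; first by model_lra.
apply: (step_ge0 (ltW lambda_gt0) (ltW beta_gt0)) => //.
- by move=> y; exact: policy_ge0.
- by move=> y; exact: policy_le.
Qed.

(** * Error estimates weighted by powers of [gamma] *)

Context (gamma : R) (gamma_gt1 : 1 < gamma) (uM : R)
  (cost_le : forall (phi : state -> R) (x : state), policy phi ->
     cost c h phi x <= uM * gamma ^+ x.1).

Local Notation q := ((1 - alpha) * gamma).
Context (q_lt1 : q < 1) (uM_ge0 : 0 <= uM).
Local Notation B := (uM / (1 - q)).

Local Ltac discount_lra := move: gamma_gt1 q_lt1 uM_ge0; model_lra.

Lemma step_discount (phi f : state -> R) (b : R) (x : state) :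
  policy phi -> 0 <= b ->
  (1 - alpha) * K phi (fun y => f y + b * gamma ^+ y.1) x <=
  (1 - alpha) * K phi f x + q * b * gamma ^+ x.1.
Proof.
move=> pphi b0; rewrite stepD stepZ mulrDr lerD2l.
have -> : q * b * gamma ^+ x.1 = (1 - alpha) * (b * gamma ^+ x.1.+1).
  by rewrite exprS; ring.
rewrite ler_wpM2l//; first by discount_lra.
rewrite ler_wpM2l//.
apply: (step_weight (ltW lambda_gt0) (ltW beta_gt0) _ _ _ (ltW gamma_gt1)).
- by move=> y; exact: policy_ge0.
- by move=> y; exact: policy_le.
Qed.

(** [greedy n] is admissible in the update of [V n.+1] and optimal in that of [V n]. Comparing both
    updates under this one policy shrinks the increment by [q]; the first increment is a one-step
    cost. *)
Lemma value_iter_increment (n : nat) (x : state) :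
  V n.+1 x <= V n x + uM * q ^+ n * gamma ^+ x.1.
Proof.
have pg m := greedy_policy m.
have q0 : 0 <= q by rewrite mulr_ge0; discount_lra.
elim: n x => [|n IH] x.
  rewrite value_iter_greedy add0r expr0 mulr1.
  have -> : K (greedy 0) (V 0%N) x = 0.
    by case: x => i []; rewrite /= !mulr0 !addr0.
  by rewrite mulr0 addr0 cost_le.
apply: le_trans (value_iter_le n.+1 x (pg n)) _.
rewrite (value_iter_greedy n) -[leRHS]addrA lerD2l exprS.
have : K (greedy n) (V n.+1) x <=
    K (greedy n) (fun y => V n y + uM * q ^+ n * gamma ^+ y.1) x.
  apply: (step_le (ltW lambda_gt0) (ltW beta_gt0)).
  - by move=> y; exact: policy_ge0.
  - by move=> y; exact: policy_le.
  - exact: IH.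
move=> /(ler_wpM2l (_ : 0 <= 1 - alpha)) le1; apply: le_trans (le1 _) _.
  discount_lra.
apply: le_trans (step_discount _ _ (pg n) _) _.
  by rewrite mulr_ge0// exprn_ge0.
by rewrite lerD2l le_eqVlt; apply/orP; left; apply/eqP; ring.
Qed.

Lemma horizon_cost_greedy (n j : nat) (x : state) :
  W (greedy n) h alpha j x <= V n x + B * q ^+ n * gamma ^+ x.1.
Proof.
have pg := greedy_policy n.
have q0 : 0 <= q by rewrite mulr_ge0; discount_lra.
have B0 : 0 <= B by rewrite divr_ge0//; discount_lra.
apply: (@horizon_cost_le _ lambda beta (greedy n) (ltW lambda_gt0)
  (ltW beta_gt0) _ _ c h alpha
  (fun y => V n y + B * q ^+ n * gamma ^+ y.1) _ _ (ltW alpha_lt1)).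
- by move=> y; exact: policy_ge0.
- by move=> y; exact: policy_le.
- move=> y; rewrite addr_ge0 ?value_iter_ge0// mulr_ge0 ?exprn_ge0//.
    by rewrite mulr_ge0// exprn_ge0.
  discount_lra.
- move=> y; apply: (@le_trans _ _ (V n.+1 y + q * (B * q ^+ n) * gamma ^+ y.1)).
    rewrite value_iter_greedy -[leRHS]addrA lerD2l; apply: step_discount => //.
    by rewrite mulr_ge0// exprn_ge0.
  have := value_iter_increment n y.
  (* [B * q ^+ n] is the sum of [uM * q ^+ m] over [m >= n]: its first term absorbs the increment
     from [V n] to [V n.+1], the rest is the discounted error. *)
  have -> : B * q ^+ n * gamma ^+ y.1 =
      uM * q ^+ n * gamma ^+ y.1 + q * (B * q ^+ n) * gamma ^+ y.1.
    by field; discount_lra.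
  discount_lra.
Qed.

Lemma horizon_cost_bound (phi : state -> R) (n : nat) (x : state) :
  policy phi -> W phi h alpha n x <= B * gamma ^+ x.1.
Proof.
move=> pphi.
have B0 : 0 <= B by rewrite divr_ge0//; discount_lra.
apply: (@horizon_cost_le _ lambda beta phi (ltW lambda_gt0)
  (ltW beta_gt0) _ _ c h alpha
  (fun y => B * gamma ^+ y.1) _ _ (ltW alpha_lt1)).
- by move=> y; exact: policy_ge0.
- by move=> y; exact: policy_le.
- by move=> y; rewrite mulr_ge0// exprn_ge0; discount_lra.
- move=> y.
  (* With [f = 0] only the weight remains; [B] then solves [uM + q * B = B]. *)
  have := step_discount (fun=> 0) y pphi B0.
  under [X in K _ X]funext do rewrite add0r.
  rewrite step_const mulr0 add0r => le1.
  apply: le_trans (lerD (cost_le y pphi) le1) _.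
  rewrite -mulrDl le_eqVlt; apply/orP; left; apply/eqP.
  by field; discount_lra.
Qed.

(** * Infinite-horizon values as real numbers *)

Context (d : measure_display) (T : measurableType d)
  (P : (state -> R) -> state -> probability T R) (Y : nat -> T -> state)
  (Y_chain : forall (phi : state -> R) (x : state), policies mu1 mu2 mu phi ->
     is_markov_chain (P phi x) Y x (trans lambda beta phi)).

(** [fine] would turn an infinite value into 0; for policies, [horizon_cost_bound] and
    [real_value_bounds] exclude this. *)
Definition real_value (phi : state -> R) (x : state) : R :=
  fine (value P Y c h alpha phi x).

Lemma real_value_bounds (phi : state -> R) (x : state) (U : R) : policy phi ->
  (forall n, W phi h alpha n x <= U) ->
  [/\ value P Y c h alpha phi x = (real_value phi x)%:E,
      forall n, W phi h alpha n x <= real_value phi x & real_value phi x <= U].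
Proof.
move=> pphi WU; rewrite /real_value.
have phi_ge0 y : 0 <= phi y.
  exact: policy_ge0.
have phi_le y : phi y <= 1 - lambda - beta.
  exact: policy_le.
have cost_ge0 y : 0 <= cost c h phi y.
  exact: policy_cost_ge0.
have [v -> [Wv vU]] := value_bounds (ltW lambda_gt0) (ltW beta_gt0) phi_ge0
  phi_le cost_ge0 (ltW alpha_lt1) (fun y => Y_chain y pphi) WU.
by [].
Qed.

Lemma real_value_itv (phi : state -> R) (x : state) : policy phi ->
  0 <= real_value phi x <= B * gamma ^+ x.1.
Proof.
move=> pphi.
have WU n : W phi h alpha n x <= B * gamma ^+ x.1.
  exact: horizon_cost_bound.
have [_ Wv vU] := real_value_bounds pphi WU.
by rewrite vU andbT (le_trans _ (Wv 0%N))// /horizon_cost big_ord0.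
Qed.

Lemma value_iter_le_value (phi : state -> R) (n : nat) (x : state) :
  policy phi -> V n x <= real_value phi x.
Proof.
move=> pphi.
have WU m : W phi h alpha m x <= B * gamma ^+ x.1.
  exact: horizon_cost_bound.
have [_ Wv _] := real_value_bounds pphi WU.
apply: le_trans (Wv n).
by exact: value_iter_le_horizon_cost.
Qed.

Lemma value_greedy_le (n : nat) (x : state) :
  real_value (greedy n) x <= V n x + B * q ^+ n * gamma ^+ x.1.
Proof.
have pg := greedy_policy n.
have WU m : W (greedy n) h alpha m x <=
    V n x + B * q ^+ n * gamma ^+ x.1.
  exact: horizon_cost_greedy.
by have [] := real_value_bounds pg WU.
Qed.

(** Horizon costs at [(i, false)] agree for all policies, so the bound for [greedy n] transfers to
    [phi]. *)
Lemma value_false_le (phi : state -> R) (n i : nat) : policy phi ->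
  real_value phi (i, false) <= V n (i, false) + B * q ^+ n * gamma ^+ i.
Proof.
move=> pphi.
have pg := greedy_policy n.
have WU m : W phi h alpha m (i, false) <=
    V n (i, false) + B * q ^+ n * gamma ^+ i.
  rewrite (value_iter_false _ _ pphi) -(value_iter_false _ _ pg).
  exact: (horizon_cost_greedy n m (i, false)).
by have [] := real_value_bounds pphi WU.
Qed.

(** * Truncation and approximation of the saved cost *)

Context (rho : R) (rho_ge0 : 0 <= rho) (rho_lt1 : rho < 1)
  (gamma_rho : gamma * rho < 1).

Lemma saved_cost_of_tail (phi : state -> R) (k : nat) : policy phi ->
  exists2 s, saved_cost_of P Y c h alpha (geom_dist rho) phi = s%:E
    & `|s - \sum_(i < k) geom_dist rho i *
            (real_value phi (i : nat, false) - real_value phi (i : nat, true))|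
      <= (1 - rho) * B * (gamma * rho) ^+ k / (1 - gamma * rho).
Proof.
move=> pphi.
pose a i :=
  geom_dist rho i * (real_value phi (i, false) - real_value phi (i, true)).
have B0 : 0 <= B by rewrite divr_ge0// subr_ge0 ltW.
have [||//||s sE s_le] :=
  @eseries_geometric R a ((1 - rho) * B) (gamma * rho) k.
- by rewrite mulr_ge0// subr_ge0 ltW.
- by rewrite mulr_ge0// ltW// (lt_trans _ gamma_gt1).
- move=> i; have pi_ge0 : 0 <= geom_dist rho i.
    by rewrite mulr_ge0 ?exprn_ge0// subr_ge0 ltW.
  have -> : (1 - rho) * B * (gamma * rho) ^+ i
      = geom_dist rho i * (B * gamma ^+ i) by rewrite /geom_dist exprMn; ring.
  rewrite /a normrM (ger0_norm pi_ge0) ler_wpM2l//.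
  have /andP[f0 f1] := real_value_itv (i, false) pphi.
  have /andP[t0 t1] := real_value_itv (i, true) pphi.
  (* Both values lie between 0 and [B * gamma ^+ i], so their difference obeys the same bound
     without a factor 2. *)
  by move: f1 t1 => /= f1 t1; rewrite ler_norml; apply/andP; split; lra.
exists s => //; rewrite -sE; apply: eq_eseriesr => i _.
have value_fin x : value P Y c h alpha phi x = (real_value phi x)%:E.
  have WU m : W phi h alpha m x <= B * gamma ^+ x.1.
    exact: horizon_cost_bound.
  by have [] := real_value_bounds pphi WU.
by rewrite !value_fin -EFinB -EFinM.
Qed.

Lemma sum_geom_dist (k : nat) : \sum_(i < k) geom_dist rho i = 1 - rho ^+ k.
Proof.
elim: k => [|k IH]; first by rewrite big_ord0 expr0 subrr.
by rewrite big_ord_recr /= IH /geom_dist exprS; ring.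
Qed.

(** [e1] is the error of value iteration, [e2] that of truncation. The upper bound uses that [V n]
    lies below the value at flag 1 for every policy; the lower bound needs [V n] nearly above it,
    which [greedy n] supplies. *)
Lemma saved_cost_of_approx (phi : state -> R) (k n : nat) (e1 e2 : R) :
  policy phi -> 0 <= e1 ->
  (forall i, (i < k)%N -> B * q ^+ n * gamma ^+ i <= e1) ->
  (1 - rho) * B * (gamma * rho) ^+ k / (1 - gamma * rho) <= e2 ->
  let S := \sum_(i < k) geom_dist rho i * V n (i : nat, false)
           - \sum_(i < k) geom_dist rho i * V n (i : nat, true) in
  exists2 s, saved_cost_of P Y c h alpha (geom_dist rho) phi = s%:E
    & s <= S + e1 + e2 /\
      (phi = greedy n -> S - e1 - e2 <= s).
Proof.
move=> pphi e1_ge0 le_e1 le_e2 S.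
have [s sE s_le] := saved_cost_of_tail k pphi; exists s => //.
move: s_le => /le_trans/(_ le_e2).
set A := \sum_(i < k) _; rewrite ler_distl => /andP[s_ge s_le].
have pi_ge0 i : 0 <= geom_dist rho i.
  by rewrite mulr_ge0 ?exprn_ge0// subr_ge0 ltW.
(* The weights sum to [1 - rho ^+ k], at most 1, so averaging does not enlarge [e1]. *)
have sum_e1 : \sum_(i < k) geom_dist rho i * e1 <= e1.
  rewrite -mulr_suml sum_geom_dist ler_piMl// lerBlDr lerDl exprn_ge0//.
have SE : S = \sum_(i < k) geom_dist rho i
    * (V n (i : nat, false) - V n (i : nat, true)).
  by rewrite /S -sumrB; apply: eq_bigr => i _; rewrite mulrBr.
split=> [|phiE].
- apply: le_trans s_le _; rewrite lerD2r.
  apply: le_trans (lerD (lexx S) sum_e1).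
  rewrite SE -big_split /=; apply: ler_sum => i _; rewrite -mulrDr ler_wpM2l//.
  have := value_false_le n i pphi.
  have := value_iter_le_value n (i : nat, true) pphi.
  by have := le_e1 i (ltn_ord i); lra.
- apply: le_trans s_ge; rewrite lerD2r.
  apply: le_trans (lerB (lexx S) sum_e1) _.
  rewrite SE -sumrB; apply: ler_sum => i _; rewrite -mulrBr ler_wpM2l//.
  have := value_iter_le_value n (i : nat, false) pphi.
  have := value_greedy_le n (i : nat, true); rewrite -phiE /=.
  by have := le_e1 i (ltn_ord i); lra.
Qed.

End Model.

(** * The thresholds for [k] and [n], and the final estimate *)

Lemma weighted_sup_le (R : realType) (mu1 mu2 mu : R) (c : R -> R)
    (h : nat -> R) (gamma uM : R) (phi : state -> R) (x : state) :
  0 < gamma ->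
  (ereal_sup [set ereal_sup [set (`|cost c h psi y| / gamma ^+ y.1)%:E
                            | y in [set: state]]
             | psi in policies mu1 mu2 mu] <= uM%:E)%E ->
  policies mu1 mu2 mu phi -> cost c h phi x <= uM * gamma ^+ x.1.
Proof.
move=> gamma_gt0 uM_bound pphi.
rewrite -ler_pdivrMr ?exprn_gt0// -lee_fin; apply: le_trans uM_bound.
apply: (@le_trans _ _ (`|cost c h phi x| / gamma ^+ x.1)%:E).
  by rewrite lee_fin ler_wpM2r ?ler_norm// invr_ge0 exprn_ge0// ltW.
apply: (@le_trans _ _ (ereal_sup [set (`|cost c h phi y| / gamma ^+ y.1)%:E
                                 | y in [set: state]])).
  by apply: ereal_sup_ubound; exists x.
by apply: ereal_sup_ubound; exists phi.
Qed.

(** With [s = 1 - gamma * rho], [g = 1 - q], [u = uM], [a = 1 - rho], the logarithm's argument in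
    [k], put in place of the power in the tail bound, gives exactly half of [eps]. *)
Lemma truncation_identity (R : realFieldType) (e s g u a : R) :
  s != 0 -> g != 0 -> u != 0 -> a != 0 ->
  a * (u / g) * (e * s * g / (2 * u * a)) / s = e / 2.
Proof. by move=> s0 g0 u0 a0; field; rewrite s0 g0 u0 a0. Qed.

(** The analogue for [n], with [w] the weight at the truncation level. The accuracy [e / 2] and the
    2 in the denominator together give [e / 4]. *)
Lemma iteration_identity (R : realFieldType) (e g u w : R) :
  g != 0 -> u != 0 -> w != 0 -> u / g * (e / 2 * g / (2 * u * w)) * w = e / 4.
Proof. by move=> g0 u0 w0; field; rewrite g0 u0 w0. Qed.

Theorem theorem6p1 (R : realType)
  (lambda beta mu1 mu2 mu : R) (c : R -> R) (h : nat -> R)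
  (lambda_gt0 : 0 < lambda) (beta_gt0 : 0 < beta)
  (mu1_gt0 : 0 < mu1) (mu12 : mu1 < mu2)
  (rates_sum : lambda + mu1 + mu2 + beta = 1)
  (mu_rate : mu = mu1 \/ mu = mu2) (lambda_lt_mu : lambda < mu)
  (c_mu1 : c mu1 = 0) (c_mu2 : 0 < c mu2)
  (h0 : h 0%N = 0)
  (h_ge0 : forall i, 0 <= h i)
  (h_nondecreasing : forall i j : nat, (i <= j)%N -> h i <= h j)
  (h_convex : forall i, h i.+1 - h i <= h i.+2 - h i.+1)
  (h_unbounded : forall M : R, exists i, M < h i)
  (h_series : forall x : R, 0 < x -> x < 1 ->
     (\sum_(0 <= i <oo) (h i * x ^+ i)%:E < +oo)%E)
  (d : measure_display) (T : measurableType d)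
  (P : (state -> R) -> state -> probability T R) (Y : nat -> T -> state)
  (Y_chain : forall (phi : state -> R) (x : state), policies mu1 mu2 mu phi ->
     is_markov_chain (P phi x) Y x (trans lambda beta phi))
  (alpha gamma : R)
  (alpha_gt0 : 0 < alpha) (alpha_lt1 : alpha < 1)
  (gamma_gt1 : 1 < gamma) (gamma_lt : gamma < 1 / (1 - alpha))
  (gamma_rho : gamma * (lambda / mu) < 1)
  (uM : R)
  (uM_bound :
     (ereal_sup [set ereal_sup [set (`|cost c h phi x| / gamma ^+ x.1)%:E
                               | x in [set: state]]
                | phi in policies mu1 mu2 mu] <= uM%:E)%E)
  (eps : R) (eps_gt0 : 0 < eps) :
  (`| saved_cost P Y (policies mu1 mu2 mu) c h alpha (geom_dist (lambda / mu))
      - (approx_saved_cost lambda beta mu1 mu2 mu c h alpha gamma uM eps)%:E |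
   <= eps%:E)%E.
Proof.
have gamma_gt0 : 0 < gamma by lra.
have mu_gt0 : 0 < mu by lra.
have alpha1 : 0 < 1 - alpha by lra.
have q_lt1 : (1 - alpha) * gamma < 1.
  by move: gamma_lt; rewrite ltr_pdivlMr// mulrC.
have q_gt0 : 0 < (1 - alpha) * gamma by rewrite mulr_gt0.
have cost_le (phi : state -> R) (x : state) :=
  @weighted_sup_le R mu1 mu2 mu c h gamma uM phi x gamma_gt0 uM_bound.
(* Serving an empty queue at rate [mu2] costs [c mu2 > 0]. Positivity of [uM] makes the arguments of
   both logarithms positive. *)
have uM_gt0 : 0 < uM.
  pose fast (x : state) : R := if x.2 then mu2 else mu.
  have fast_policy : policies mu1 mu2 mu fast by split=> // i; right.
  have := cost_le fast (0%N, true) fast_policy.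
  by rewrite /cost /= h0 expr0 mulr1 addr0; exact: lt_le_trans.
have eps2_ge0 : 0 <= eps / 2 by lra.
rewrite /approx_saved_cost.
set rho := lambda / mu in gamma_rho *.
have rho_gt0 : 0 < rho by rewrite divr_gt0.
have rho_lt1 : rho < 1 by rewrite ltr_pdivrMr// mul1r.
have rho1 : 0 < 1 - rho by rewrite subr_gt0.
have gamma_rho1 : 0 < 1 - gamma * rho by rewrite subr_gt0.
have q1 : 0 < 1 - (1 - alpha) * gamma by rewrite subr_gt0.
have uM1 : 0 < uM / (1 - (1 - alpha) * gamma) by rewrite divr_gt0.
set kz := truncation _ _ _ _ _; set n := n_iter _ _ _ _ _.
set k := pos_part (kz + 1).
have tail_le : (1 - rho) * (uM / (1 - (1 - alpha) * gamma)) * (gamma * rho) ^+ k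
    / (1 - gamma * rho) <= eps / 2.
  set X := eps * (1 - gamma * rho) * (1 - (1 - alpha) * gamma)
    / (2 * uM * (1 - rho)).
  have X_gt0 : 0 < X by rewrite /X divr_gt0 ?mulr_gt0 ?divr_gt0.
  have gr_le : (gamma * rho) ^+ k <= X.
    apply: expr_le_log_base => //; first by rewrite mulr_gt0.
    (* Negative [kz] is covered too: [k] is at least [kz + 1], hence above the ceiling. *)
    have := le_pos_part (kz + 1); rewrite -/k; apply: le_trans.
    by rewrite lerDl.
  rewrite -(truncation_identity eps (lt0r_neq0 gamma_rho1) (lt0r_neq0 q1)
    (lt0r_neq0 uM_gt0) (lt0r_neq0 rho1)) -/X.
  by rewrite ler_pM2r ?invr_gt0// ler_pM2l// mulr_gt0.
have iter_le i : (i < k)%N -> uM / (1 - (1 - alpha) * gamma)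
    * ((1 - alpha) * gamma) ^+ n * gamma ^+ i <= eps / 2.
  move=> ik.
  set X := eps / 2 * (1 - (1 - alpha) * gamma) / (2 * uM * gamma ^+ pos_part kz).
  have gk_gt0 : 0 < gamma ^+ pos_part kz by rewrite exprn_gt0.
  have X_gt0 : 0 < X by rewrite /X divr_gt0 ?mulr_gt0 ?divr_gt0.
  have qn_le : ((1 - alpha) * gamma) ^+ n <= X.
    by apply: expr_le_log_base => //; exact: le_pos_part.
  (* The single [n] chosen for the last index serves all smaller ones, as the weights increase with
     [i]. *)
  have gi_le : gamma ^+ i <= gamma ^+ pos_part kz.
    by rewrite ler_weXn2l ?(ltW gamma_gt1)// leq_pos_part.
  apply: (@le_trans _ _ (uM / (1 - (1 - alpha) * gamma) * X
                          * gamma ^+ pos_part kz)).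
    apply: ler_pM => //.
    - by apply: mulr_ge0; [exact: ltW | apply: exprn_ge0; exact: ltW].
    - by apply: exprn_ge0; exact: ltW.
    - by rewrite ler_pM2l.
  rewrite iteration_identity ?lt0r_neq0//.
  by rewrite ler_wpM2l ?(ltW eps_gt0)// lef_pV2 ?posrE// ler_nat.
have c_mu1_ge0 : 0 <= c mu1 by rewrite c_mu1.
have approx phi pphi := @saved_cost_of_approx R lambda beta mu1 mu2 mu c h
  lambda_gt0 beta_gt0 mu1_gt0 mu12 rates_sum mu_rate c_mu1_ge0 (ltW c_mu2) h_ge0
  alpha alpha_gt0 alpha_lt1 gamma gamma_gt1 uM cost_le q_lt1 (ltW uM_gt0)
  d T P Y Y_chain rho (ltW rho_gt0) rho_lt1 gamma_rho phi k n (eps / 2) (eps / 2)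
  pphi eps2_ge0 iter_le tail_le.
clear iter_le tail_le.
set S := \sum_(i < k) _ - _ in approx *; clearbody S.
have s_le : (saved_cost P Y (policies mu1 mu2 mu) c h alpha (geom_dist rho)
    <= (S + eps)%:E)%E.
  apply: ge_ereal_sup => _ [phi pphi <-].
  have [s -> [s_le _]] := approx phi pphi.
  by rewrite lee_fin; lra.
(* The policy [greedy n] is the witness for the lower bound on the supremum. *)
have s_ge : ((S - eps)%:E
    <= saved_cost P Y (policies mu1 mu2 mu) c h alpha (geom_dist rho))%E.
  have pg := greedy_policy lambda beta mu1 mu2 mu c h alpha n.
  have [s sE [_ /(_ erefl) s_ge]] := approx _ pg.
  apply: (@le_trans _ _ s%:E); first by rewrite lee_fin; lra.
  by rewrite -sE; apply: ereal_sup_ubound; eexists; first exact: pg.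
(* The two real bounds rule out infinite values of the supremum. *)
move: s_le s_ge; case: saved_cost => [s||] //=; rewrite ?lee_fin => s_le s_ge.
by rewrite ler_norml; apply/andP; split; lra.
Qed.
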